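(* Let $A \in \mathbb{H}^{m\times n}$ have rank $\nu$, let $S_2 \in \mathbb{H}^{l\times m}$ and $T_2 \in \mathbb{H}^{n\times t}$, and let $X = T_2 (S_2 A T_2)^{(1)} S_2$, where $(S_2AT_2)^{(1)}$ is a fixed but arbitrary $\{1\}$-inverse of $S_2AT_2$. Then: (a) $AXA=A$ if and only if $\operatorname{rank}(S_2AT_2)=\nu$. (b) $XAX=X$ and $\mathcal{R}_l(X)=\mathcal{R}_l(S_2)$ if and only if $\operatorname{rank}(S_2AT_2)=\operatorname{rank}(S_2)$. (c) $XAX=X$ and $\mathcal{N}_l(X)=\mathcal{N}_l(T_2)$ if and only if $\operatorname{rank}(S_2AT_2)=\operatorname{rank}(T_2)$. (d) $X$ is the unique matrix $A^{(2)}_{l,(S_2,T_2)}$, i.e. the unique matrix in $\mathbb{H}^{n\times m}$ satisfying $XAX=X$, $\mathcal{R}_l(X)=\mathcal{R}_l(S_2)$ and $\mathcal{N}_l(X)=\mathcal{N}_l(T_2)$, if and only if $\operatorname{rank}(S_2AT_2)=\operatorname{rank}(S_2)=\operatorname{rank}(T_2)$. (e) $X$ is the unique matrix $A^{(1,2)}_{l,(S_2,T_2)}$, i.e. the unique matrix in $\mathbb{H}^{n\times m}$ satisfying $AXA=A$, $XAX=X$, $\mathcal{R}_l(X)=\mathcal{R}_l(S_2)$ and $\mathcal{N}_l(X)=\mathcal{N}_l(T_2)$, if and only if $\operatorname{rank}(S_2AT_2)=\operatorname{rank}(S_2)=\operatorname{rank}(T_2)=\nu$.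
   Context: $\mathbb{H}$ denotes the real quaternions and $\mathbb{H}^{m\times n}$ the set of $m\times n$ quaternion matrices. For $B\in\mathbb{H}^{m\times n}$, the left range and left null space are $\mathcal{R}_l(B)=\{xB : x\in\mathbb{H}^{1\times m}\}\subseteq\mathbb{H}^{1\times n}$ and $\mathcal{N}_l(B)=\{x\in\mathbb{H}^{1\times m} : xB=0\}$; these are subspaces of left quaternion vector spaces. The rank of $B$ is the maximal number of right linearly independent columns of $B$ (equivalently, the maximal number of left linearly independent rows). A $\{1\}$-inverse of $B\in\mathbb{H}^{m\times n}$ is any $Y\in\mathbb{H}^{n\times m}$ with $BYB=B$. *)

(* Defs.v *)
From HB Require Import structures.
From mathcomp Require Import all_boot all_order all_algebra.
From mathcomp Require Import ring.
From mathcomp Require Import boolp classical_sets reals.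

Set Implicit Arguments.
Unset Strict Implicit.
Unset Printing Implicit Defensive.

Import GRing.Theory.
Local Open Scope ring_scope.
Local Open Scope classical_set_scope.

(* [Quat a b c d] is a + b i + c j + d k. *)
Record quat (R : realType) : Type :=
  Quat { qre : R; qi : R; qj : R; qk : R }.

Definition quat_tuple (R : realType) (x : quat R) : R * R * R * R :=
  (qre x, qi x, qj x, qk x).

Definition tuple_quat (R : realType) (u : R * R * R * R) : quat R :=
  let: (a, b, c, d) := u in Quat a b c d.

Lemma quat_tupleK (R : realType) : cancel (@quat_tuple R) (@tuple_quat R).
Proof. by case. Qed.

HB.instance Definition _ (R : realType) :=
  Choice.copy (quat R) (can_type (@quat_tupleK R)).

Definition addquat (R : realType) (x y : quat R) : quat R :=
  Quat (qre x + qre y) (qi x + qi y) (qj x + qj y) (qk x + qk y).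

Definition oppquat (R : realType) (x : quat R) : quat R :=
  Quat (- qre x) (- qi x) (- qj x) (- qk x).

(* Determined by i^2 = j^2 = k^2 = ijk = -1. *)
Definition mulquat (R : realType) (x y : quat R) : quat R :=
  Quat (qre x * qre y - qi x * qi y - qj x * qj y - qk x * qk y)
       (qre x * qi y + qi x * qre y + qj x * qk y - qk x * qj y)
       (qre x * qj y - qi x * qk y + qj x * qre y + qk x * qi y)
       (qre x * qk y + qi x * qj y - qj x * qi y + qk x * qre y).

Lemma addquatA (R : realType) : associative (@addquat R).
Proof. by move=> x y z; rewrite /addquat /= !addrA. Qed.

Lemma addquatC (R : realType) : commutative (@addquat R).
Proof. by move=> x y; congr Quat; rewrite addrC. Qed.

Lemma add0quat (R : realType) : left_id (Quat 0 0 0 0) (@addquat R).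
Proof. by case=> a b c d; rewrite /addquat /= !add0r. Qed.

Lemma addNquat (R : realType) : left_inverse (Quat 0 0 0 0) (@oppquat R) (@addquat R).
Proof. by case=> a b c d; rewrite /addquat /= !addNr. Qed.

HB.instance Definition _ (R : realType) :=
  GRing.isZmodule.Build (quat R) (@addquatA R) (@addquatC R) (@add0quat R) (@addNquat R).

Lemma mulquatA (R : realType) : associative (@mulquat R).
Proof. by move=> x y z; rewrite /mulquat /=; congr Quat; ring. Qed.

Lemma mul1quat (R : realType) : left_id (Quat 1 0 0 0) (@mulquat R).
Proof. by case=> a b c d; rewrite /mulquat /=; congr Quat; ring. Qed.

Lemma mulquat1 (R : realType) : right_id (Quat 1 0 0 0) (@mulquat R).
Proof. by case=> a b c d; rewrite /mulquat /=; congr Quat; ring. Qed.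

Lemma mulquatDl (R : realType) : left_distributive (@mulquat R) (@addquat R).
Proof. by move=> x y z; rewrite /mulquat /addquat /=; congr Quat; ring. Qed.

Lemma mulquatDr (R : realType) : right_distributive (@mulquat R) (@addquat R).
Proof. by move=> x y z; rewrite /mulquat /addquat /=; congr Quat; ring. Qed.

Lemma onequat_neq0 (R : realType) : Quat 1 0 0 0 != 0 :> quat R.
Proof. by apply/eqP => -[/eqP]; rewrite oner_eq0. Qed.

HB.instance Definition _ (R : realType) :=
  GRing.Zmodule_isNzRing.Build (quat R) (@mulquatA R) (@mul1quat R) (@mulquat1 R)
    (@mulquatDl R) (@mulquatDr R) (@onequat_neq0 R).

(* Right linear independence of the columns of [B] with index in [J]: the
   scalars stand on the right of the entries. *)
Definition right_free_cols (R : realType) (m n : nat)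
    (B : 'M[quat R]_(m, n)) (J : {set 'I_n}) : Prop :=
  forall c : 'I_n -> quat R,
    (forall i : 'I_m, \sum_(j in J) B i j * c j = 0) ->
    forall j, j \in J -> c j = 0.

(* [\rank] of the library is only available over a field. *)
Definition qrank (R : realType) (m n : nat) (B : 'M[quat R]_(m, n)) : nat :=
  (\max_(J : {set 'I_n} | `[< right_free_cols B J >]) #|J|)%N.

Definition lrange (R : realType) (m n : nat) (B : 'M[quat R]_(m, n)) :
    set 'rV[quat R]_n :=
  range (fun x : 'rV[quat R]_m => x *m B).

Definition lnull (R : realType) (m n : nat) (B : 'M[quat R]_(m, n)) :
    set 'rV[quat R]_m :=
  [set x | x *m B = 0].

Definition inverse1 (R : realType) (m n : nat)
    (B : 'M[quat R]_(m, n)) (Y : 'M[quat R]_(n, m)) : Prop :=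
  B *m Y *m B = B.

(* [X] satisfies the equations defining A^(2)_{l,(S,T)}. *)
Definition is_inv2 (R : realType) (m n l t : nat) (A : 'M[quat R]_(m, n))
    (S : 'M[quat R]_(l, m)) (T : 'M[quat R]_(n, t))
    (X : 'M[quat R]_(n, m)) : Prop :=
  [/\ X *m A *m X = X, lrange X = lrange S & lnull X = lnull T].

(* [X] satisfies the equations defining A^(1,2)_{l,(S,T)}. *)
Definition is_inv12 (R : realType) (m n l t : nat) (A : 'M[quat R]_(m, n))
    (S : 'M[quat R]_(l, m)) (T : 'M[quat R]_(n, t))
    (X : 'M[quat R]_(n, m)) : Prop :=
  [/\ A *m X *m A = A, X *m A *m X = X, lrange X = lrange S
    & lnull X = lnull T].

(* Main.v *)
(** Every quaternion matrix [B] factors as [B = (B E) D] with [B E] having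
    [qrank B] right independent columns.  Hence [qrank B] is the least inner
    dimension of a factorization of [B], a description symmetric in rows and
    columns, and [qrank (B C) = qrank B] (resp. [qrank (C B) = qrank B]) forces
    [B = B C U] (resp. [B = V C B]).  Each rank condition of the theorem thus
    becomes a matrix identity such as [S = S A T U], from which the
    {1}-inverse is cancelled. *)
Require Import Defs.
From HB Require Import structures.
From mathcomp Require Import all_boot all_order all_algebra.
From mathcomp Require Import ring.
From mathcomp Require Import boolp classical_sets reals.

Set Implicit Arguments.
Unset Strict Implicit.
Unset Printing Implicit Defensive.

Import GRing.Theory.
Local Open Scope ring_scope.

(** * Division in the quaternions and right independence of columns *)

Lemma quat_inverse (R : realType) (x : quat R) :
  x != 0 -> exists2 y, y * x = 1 & x * y = 1.
Proof.
case: x => a b c d x0.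
have sq (u v : R) : (u ^+ 2 + v ^+ 2 == 0) = (u == 0) && (v == 0).
  by rewrite Num.Theory.paddr_eq0 ?Num.Theory.sqr_ge0 // !sqrf_eq0.
have n0 : (a ^+ 2 + b ^+ 2) + (c ^+ 2 + d ^+ 2) != 0.
  apply: contraNneq x0 => /eqP.
  rewrite Num.Theory.paddr_eq0 ?Num.Theory.addr_ge0 ?Num.Theory.sqr_ge0 // !sq.
  by case/andP => /andP[/eqP-> /eqP->] /andP[/eqP-> /eqP->].
set N := (_ + _) in n0.
have mulE (u v : quat R) : u * v = mulquat u v by [].
have oneE : 1 = Quat 1 0 0 0 :> quat R by [].
(* The conjugate divided by the squared norm [N]. *)
exists (Quat (a / N) (- b / N) (- c / N) (- d / N));
  by rewrite mulE oneE /mulquat /=; congr Quat; rewrite /N; field; exact: n0.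
Qed.

(** Right independence of all columns, phrased as a trivial kernel so that it passes through matrix
    products. *)
Definition col_free (R : realType) (m n : nat) (B : 'M[quat R]_(m, n)) : Prop :=
  forall x : 'cV[quat R]_n, B *m x = 0 -> x = 0.

Section QuatMatrix.

Variable R : realType.
Implicit Types m n p r k : nat.

Lemma col_mulmx m n p (j : 'I_p) (B : 'M[quat R]_(m, n)) (C : 'M[quat R]_(n, p)) :
  col j (B *m C) = B *m col j C.
Proof. by rewrite !colE mulmxA. Qed.

Lemma col_free_mulmxI m n p (B : 'M[quat R]_(m, n)) (C D : 'M[quat R]_(n, p)) :
  col_free B -> B *m C = B *m D -> C = D.
Proof.
move=> freeB eqBCD; apply/matrixP => i j; apply/eqP; rewrite -subr_eq0; apply/eqP.
suff /colP/(_ i): col j (C - D) = 0 by rewrite !mxE.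
by apply: freeB; rewrite -col_mulmx mulmxBr eqBCD subrr col0.
Qed.

Lemma col_free_mulmxr m n p (B : 'M[quat R]_(m, n)) (C : 'M[quat R]_(n, p)) :
  col_free (B *m C) -> col_free C.
Proof. by move=> freeBC x Cx0; apply: freeBC; rewrite -mulmxA Cx0 mulmx0. Qed.

Lemma linv_col_free m n (B : 'M[quat R]_(m, n)) (W : 'M[quat R]_(n, m)) :
  W *m B = 1%:M -> col_free B.
Proof. by move=> WB x Bx; rewrite -[x]mul1mx -WB -mulmxA Bx mulmx0. Qed.

Lemma right_free_colsP m n (B : 'M[quat R]_(m, n)) (J : {set 'I_n}) :
  right_free_cols B J <-> col_free (colsub (@enum_val _ (mem J)) B).
Proof.
split=> [freeJ x Bx0 | freeB c Bc0 j jJ].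
  apply/colP => i; rewrite mxE.
  pose jJ := enum_valP i.
  have := freeJ (fun j => x (enum_rank_in jJ j) 0) _ _ jJ.
  rewrite enum_valK_in; apply => h.
  move/colP/(_ h): Bx0; rewrite !mxE => Bx0; rewrite -[RHS]Bx0.
  rewrite big_enum_val; apply: eq_bigr => k _.
  by rewrite enum_valK_in !mxE.
have /colP/(_ (enum_rank_in jJ j)) :
    \col_i c (@enum_val _ (mem J) i) = 0 :> 'cV_(#|J|).
  apply: freeB; apply/colP => i; rewrite !mxE -[RHS](Bc0 i) [RHS]big_enum_val.
  by apply: eq_bigr => k _; rewrite !mxE.
by rewrite !mxE enum_rankK_in.
Qed.

(** * Rank factorization *)

Lemma qrank_basis m n (B : 'M[quat R]_(m, n)) :
  exists J : {set 'I_n}, [/\ #|J| = qrank B, right_free_cols B J &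
    forall K : {set 'I_n}, right_free_cols B K -> (#|K| <= #|J|)%N].
Proof.
have free0 : `[< right_free_cols B (finset.set0 : {set 'I_n}) >].
  by apply/asboolP => c _ j; rewrite inE.
rewrite /qrank (bigop.bigmax_eq_arg _ free0).
case: arg_maxnP => // J /asboolP freeJ maxJ.
by exists J; split=> // K /asboolP /maxJ.
Qed.

(** [E] selects a maximal right independent set [J] of columns, and [D] holds the coordinates of
    every column of [B] in terms of these. *)
Lemma qrank_factor m n (B : 'M[quat R]_(m, n)) :
  exists (E : 'M_(n, qrank B)) (D : 'M_(qrank B, n)),
    col_free (B *m E) /\ B = B *m E *m D.
Proof.
have [J [<- freeJ maxJ]] := qrank_basis B.
exists (colsub (@enum_val _ (mem J)) 1%:M).
have span j : exists x : 'cV_#|J|, col j B = colsub (@enum_val _ (mem J)) B *m x.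
  have [jJ | jJ] := boolP (j \in J).
    exists (delta_mx (enum_rank_in jJ j) 0); rewrite -colE.
    by apply/colP => i; rewrite !mxE enum_rankK_in.
  (* By maximality, adding column [j] creates a dependence. Its coefficient [c j] is nonzero, as [J]
     itself is independent, so column [j] is obtained by dividing on the right by [c j]. *)
  have : ~ right_free_cols B (j |: J)%SET.
    by move=> /maxJ; rewrite cardsU1 jJ add1n ltnn.
  move=> /existsNP[c /not_implyP[Bc /existsNP[k /not_implyP[kJ ck]]]].
  have {}Bc i : B i j * c j + \sum_(j in J) B i j * c j = 0.
    by rewrite -[RHS](Bc i) big_setU1.
  have cj : c j != 0.
    apply/eqP => cj0; apply: ck; move: kJ; rewrite !inE => /orP[/eqP-> //|].
    by apply: freeJ => i; rewrite -[RHS](Bc i) cj0 mulr0 add0r.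
  have [y _ cy] := quat_inverse cj.
  exists (\col_i (- (c (enum_val i) * y))); apply/colP => i; rewrite !mxE.
  have -> : B i j = - (\sum_(j in J) B i j * c j) * y.
    by rewrite -[LHS]mulr1 -cy mulrA; congr (_ * _); apply/eqP; rewrite -addr_eq0 Bc.
  rewrite mulNr mulr_suml -sumrN big_enum_val; apply: eq_bigr => h _.
  by rewrite !mxE mulrN mulrA.
have [x xP] := choice span.
exists (\matrix_(i, j) x j i 0); rewrite mulmx_colsub mulmx1.
split; first exact/right_free_colsP.
apply/matrixP => i j; have /colP/(_ i) := xP j; rewrite !mxE => ->.
by apply: eq_bigr => h _; rewrite !mxE.
Qed.

Lemma qrank_le_cols m n (B : 'M[quat R]_(m, n)) : (qrank B <= n)%N.
Proof.
by apply/bigmax_leqP => J _; rewrite -[n in (_ <= n)%N]card_ord max_card.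
Qed.

(* If [q] is the residue of the first column modulo the others, a nonzero entry
   of [q] yields a row [w] annihilating the other columns with [w *m q = 1]. *)
Lemma col_free_linv m n (B : 'M[quat R]_(m, n)) :
  col_free B -> exists W : 'M_(n, m), W *m B = 1%:M.
Proof.
elim: n B => [|n IHn] B freeB; first by exists 0; apply/matrixP => -[].
rewrite -[n.+1]/(1 + n)%N in B freeB *.
rewrite -[B]hsubmxK in freeB *; set b := lsubmx B in freeB *; set C := rsubmx B in freeB *.
have freeC : col_free C.
  move=> x Cx; have := freeB (col_mx 0 x).
  by rewrite mul_row_col mulmx0 add0r => /(_ Cx)/eqP; rewrite col_mx_eq0 => /andP[_ /eqP].
have [W WC] := IHn _ freeC.
pose q := b - C *m (W *m b).
have /cV0Pn[i qi] : q != 0.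
  apply/eqP => q0; have := freeB (col_mx 1%:M (- (W *m b))).
  rewrite mul_row_col mulmx1 mulmxN => /(_ q0)/eqP; rewrite col_mx_eq0 => /andP[/eqP].
  by move/matrixP/(_ 0 0)/eqP; rewrite !mxE eqxx oner_eq0.
have [y yq _] := quat_inverse qi.
pose w := y *: row i (1%:M - C *m W).
have wb : w *m b = 1%:M.
  rewrite -scalemxAl -row_mul mulmxBl mul1mx -mulmxA -/q.
  by apply/matrixP => h k; rewrite !ord1 [LHS]mxE [X in y * X]mxE yq mxE eqxx.
have wC : w *m C = 0.
  by rewrite -scalemxAl -row_mul mulmxBl mul1mx -mulmxA WC mulmx1 subrr row0 scaler0.
exists (col_mx w (W - W *m b *m w)).
rewrite mul_col_row wb wC !mulmxBl WC -!mulmxA wb wC mulmx1 !mulmx0 subrr subr0.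
by rewrite -scalar_mx_block.
Qed.

(** * Invariance of dimension through the real part of the trace *)

Lemma qreD (x y : quat R) : qre (x + y) = qre x + qre y.
Proof. by []. Qed.

Lemma qre_mulC (x y : quat R) : qre (x * y) = qre (y * x).
Proof. have mulE (u v : quat R) : u * v = mulquat u v by [].
by rewrite !mulE /=; ring. Qed.

(** Quaternions do not commute, so the trace is not cyclic; its real part is, because [qre (x * y)]
    is symmetric in [x] and [y]. *)
Lemma qre_trace_mulC m n (B : 'M[quat R]_(m, n)) (C : 'M[quat R]_(n, m)) :
  qre (\tr (B *m C)) = qre (\tr (C *m B)).
Proof.
have qre_tr p q (M : 'M[quat R]_(p, q)) (N : 'M[quat R]_(q, p)) :
    qre (\tr (M *m N)) = \sum_i \sum_j qre (M i j * N j i).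
  rewrite /mxtrace (big_morph _ qreD (erefl : qre 0 = 0)); apply: eq_bigr => i _.
  by rewrite mxE (big_morph _ qreD (erefl : qre 0 = 0)).
rewrite !qre_tr exchange_big; apply: eq_bigr => i _; apply: eq_bigr => j _.
exact: qre_mulC.
Qed.

Lemma qre_trace1 n : qre (\tr (1%:M : 'M[quat R]_n)) = n%:R.
Proof.
rewrite mxtrace1; elim: n => // n IHn.
by rewrite -addn1 natrD qreD IHn natrD.
Qed.

Lemma inverse_dim m n (B : 'M[quat R]_(m, n)) (C : 'M[quat R]_(n, m)) :
  B *m C = 1%:M -> C *m B = 1%:M -> m = n.
Proof.
move=> BC CB; have := qre_trace_mulC B C; rewrite BC CB !qre_trace1.
by move/eqP; rewrite Num.Theory.eqr_nat => /eqP.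
Qed.

(** Factor a left inverse [W] of [B] through its rank: [W *m E] is free with right inverse [D *m B],
    hence invertible, so [n] equals [qrank W], which is at most [m]. *)
Lemma col_free_leq m n (B : 'M[quat R]_(m, n)) : col_free B -> (n <= m)%N.
Proof.
move=> /col_free_linv[W WB]; have [E [D [freeWE WED]]] := qrank_factor W.
have WEDB : W *m E *m (D *m B) = 1%:M by rewrite mulmxA -WED.
have DBWE : D *m B *m (W *m E) = 1%:M.
  by apply: (col_free_mulmxI freeWE); rewrite mulmxA WEDB mul1mx mulmx1.
by rewrite (inverse_dim WEDB DBWE) qrank_le_cols.
Qed.

(* A nonzero column of [1 - C B], being killed by [B], would extend the columns
   of [C] to [n + 1] independent ones. *)
Lemma mulmx1C_quat n (B C : 'M[quat R]_n) : B *m C = 1%:M -> C *m B = 1%:M.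
Proof.
move=> BC; apply/eqP; rewrite eq_sym -subr_eq0; apply/negPn/negP => e0.
have /existsP[j ej] : [exists j, col j (1%:M - C *m B) != 0].
  apply: contraNT e0 => /existsPn e0; apply/eqP/matrixP => i j.
  by have /negPn/eqP/colP/(_ i) := e0 j; rewrite !mxE.
set e := col j _ in ej.
have Be : B *m e = 0 by rewrite -col_mulmx mulmxBr mulmx1 mulmxA BC mul1mx subrr col0.
suff /col_free_leq : col_free (row_mx C e) by rewrite addn1 ltnn.
move=> x; rewrite -[x]vsubmxK mul_row_col => eqx.
have u0 : usubmx x = 0.
  have := congr1 (mulmx B) eqx.
  by rewrite mulmxDr !mulmxA BC Be mul0mx mul1mx addr0 mulmx0.
move: eqx; rewrite u0 mulmx0 add0r => ev.
suff -> : dsubmx x = 0 by rewrite col_mx0.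
have /cV0Pn[i ei] := ej; have [y yei _] := quat_inverse ei.
apply/colP => k; rewrite !ord1 -[LHS]mul1r -yei -mulrA.
by move/colP/(_ i): ev; rewrite mxE big_ord1 => ->; rewrite !mxE mulr0.
Qed.

(** * Rank of products and the case of equality *)

Lemma qrank_leq_inner m r n (P : 'M[quat R]_(m, r)) (Q : 'M[quat R]_(r, n)) :
  (qrank (P *m Q) <= r)%N.
Proof.
have [E [_ [freeE _]]] := qrank_factor (P *m Q).
by rewrite -mulmxA in freeE; exact: col_free_leq (col_free_mulmxr freeE).
Qed.

Lemma qrank_mulmxl m n p (B : 'M[quat R]_(m, n)) (C : 'M[quat R]_(n, p)) :
  (qrank (B *m C) <= qrank B)%N.
Proof.
have [E [D [_ BED]]] := qrank_factor B.
by rewrite {1}BED -mulmxA; exact: qrank_leq_inner.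
Qed.

Lemma qrank_mulmxr m n p (B : 'M[quat R]_(m, n)) (C : 'M[quat R]_(n, p)) :
  (qrank (B *m C) <= qrank C)%N.
Proof.
have [E [D [_ CED]]] := qrank_factor C.
by rewrite {1}CED mulmxA; exact: qrank_leq_inner.
Qed.

Lemma qrank_mulmx_mid m n p q (B : 'M[quat R]_(m, n)) (C : 'M[quat R]_(n, p))
    (D : 'M[quat R]_(p, q)) : (qrank (B *m C *m D) <= qrank C)%N.
Proof. exact: leq_trans (qrank_mulmxl _ _) (qrank_mulmxr _ _). Qed.

Lemma col_free_rinv n (G : 'M[quat R]_n) :
  col_free G -> exists W : 'M_n, G *m W = 1%:M.
Proof. by move=> /col_free_linv[W /mulmx1C_quat]; exists W. Qed.

(** Equality of ranks makes [D *m C *m F] square; it is free, hence invertible, and inverting it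
    recovers [B] from [B *m C]. *)
Lemma qrank_eq_mulmxl m n p (B : 'M[quat R]_(m, n)) (C : 'M[quat R]_(n, p)) :
  qrank (B *m C) = qrank B -> exists U, B = B *m C *m U.
Proof.
move=> eqr; have [E [D [_ BED]]] := qrank_factor B.
have [F [_ [freeF _]]] := qrank_factor (B *m C).
move: (qrank _) eqr F freeF => r eqr; rewrite {r}eqr => F freeF.
have eqF : B *m C *m F = B *m E *m (D *m C *m F) by rewrite !mulmxA -BED.
have [W GW] : exists W, D *m C *m F *m W = 1%:M.
  by apply: col_free_rinv; apply: (@col_free_mulmxr _ _ _ (B *m E)); rewrite -eqF.
exists (F *m W *m D).
by rewrite !mulmxA eqF -(mulmxA _ _ W) GW mulmx1.
Qed.

(** Transposition does not reverse products over a noncommutative ring, so this side is argued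
    separately: [C] stays left cancellable on the column basis [B *m E]. *)
Lemma qrank_eq_mulmxr m n p (B : 'M[quat R]_(m, n)) (C : 'M[quat R]_(p, m)) :
  qrank (C *m B) = qrank B -> exists V, B = V *m (C *m B).
Proof.
move=> eqr; have [E [D [_ BED]]] := qrank_factor B.
have [F [_ [freeF _]]] := qrank_factor (C *m B).
move: (qrank (C *m B)) eqr F freeF => r eqr; rewrite {r}eqr => F freeF.
have eqF : C *m B *m F = C *m (B *m E) *m (D *m F).
    by rewrite (mulmxA _ D) -(mulmxA C _ D) -BED.
have [W GW] : exists W, D *m F *m W = 1%:M.
  by apply: col_free_rinv; apply: (@col_free_mulmxr _ _ _ (C *m (B *m E))); rewrite -eqF.
(* Since [D *m F] is invertible, a left inverse of [C *m B *m F] yields one of [C *m (B *m E)]. *)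
have freeCBE : col_free (C *m (B *m E)).
  have [Z ZF] := col_free_linv freeF.
  apply: (@linv_col_free _ _ _ (D *m F *m Z)).
  have -> : C *m (B *m E) = C *m B *m F *m W by rewrite eqF -mulmxA GW mulmx1.
  by rewrite mulmxA -(mulmxA (D *m F)) ZF mulmx1.
have [Z ZP] := col_free_linv freeCBE.
exists (B *m E *m Z).
have CBE : C *m B = C *m (B *m E) *m D by rewrite -mulmxA -BED.
by rewrite CBE mulmxA -(mulmxA _ Z) ZP mulmx1.
Qed.

(** * Left ranges, left null spaces and uniqueness *)

Lemma lrangeP (m n p : nat) (B : 'M[quat R]_(m, n)) (C : 'M[quat R]_(p, n)) :
  (lrange B `<=` lrange C)%classic <-> exists Z, B = Z *m C.
Proof.
split=> [sBC | [Z ->] _ [x _ <-]]; last by exists (x *m Z); rewrite ?mulmxA.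
have rowE i : exists z, row i B = z *m C.
  by have [|z _ zC] := sBC (row i B); [exists (delta_mx 0 i); rewrite -?rowE | exists z].
have [z zP] := choice rowE.
exists (\matrix_i z i); apply/row_matrixP => i.
by rewrite row_mul rowK zP.
Qed.

Lemma lnull_mulmx (m n p q : nat) (B : 'M[quat R]_(m, n)) (C : 'M[quat R]_(m, p))
    (M : 'M[quat R]_(q, m)) :
  (lnull B `<=` lnull C)%classic -> M *m B = 0 -> M *m C = 0.
Proof.
move=> sBC MB; apply/row_matrixP => i; rewrite row_mul row0.
by apply: sBC; rewrite /lnull /= -row_mul MB row0.
Qed.

(** Both matrices equal [X' *m A *m X]: [1 - X' A] kills [X'], hence [X] by equality of null spaces,
    while equality of ranges gives [X' = Z X], on which [X A X = X] acts. *)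
Lemma is_inv2_inj (m n l t : nat) (A : 'M[quat R]_(m, n)) (S : 'M[quat R]_(l, m))
    (T : 'M[quat R]_(n, t)) (X X' : 'M[quat R]_(n, m)) :
  is_inv2 A S T X -> is_inv2 A S T X' -> X = X'.
Proof.
move=> [XAX rX nX] [X'AX' rX' nX'].
transitivity (X' *m A *m X).
  apply/eqP; rewrite -subr_eq0 -[X in X - _]mul1mx -mulmxBl; apply/eqP.
  apply: (@lnull_mulmx _ _ _ _ X'); first by rewrite nX nX'.
  by rewrite mulmxBl mul1mx X'AX' subrr.
have [|Z ->] := (lrangeP X' X).1; first by rewrite rX rX'.
by rewrite -!mulmxA (mulmxA X) XAX.
Qed.

End QuatMatrix.

Local Open Scope classical_set_scope.

Theorem theorem4p4 (R : realType) (m n l t nu : nat)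
    (A : 'M[quat R]_(m, n)) (S2 : 'M[quat R]_(l, m)) (T2 : 'M[quat R]_(n, t))
    (Y : 'M[quat R]_(t, l)) (X : 'M[quat R]_(n, m))
    (hA : qrank A = nu)
    (hY : inverse1 (S2 *m A *m T2) Y)
    (hX : X = T2 *m Y *m S2) :
  (A *m X *m A = A <-> qrank (S2 *m A *m T2) = nu) /\
  ((X *m A *m X = X /\ lrange X = lrange S2) <->
     qrank (S2 *m A *m T2) = qrank S2) /\
  ((X *m A *m X = X /\ lnull X = lnull T2) <->
     qrank (S2 *m A *m T2) = qrank T2) /\
  (unique (is_inv2 A S2 T2) X <->
     (qrank (S2 *m A *m T2) = qrank S2 /\ qrank S2 = qrank T2)) /\
  (unique (is_inv12 A S2 T2) X <->
     [/\ qrank (S2 *m A *m T2) = qrank S2, qrank S2 = qrank T2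
       & qrank T2 = nu]).
Proof.
rewrite /inverse1 in hY; set M := S2 *m A *m T2 in hY *.
have leMS : (qrank M <= qrank S2)%N by rewrite /M -mulmxA qrank_mulmxl.
have leMT : (qrank M <= qrank T2)%N by exact: qrank_mulmxr.
have leMA : (qrank M <= qrank A)%N.
  exact: qrank_mulmx_mid.
have XAX_def : X *m A *m X = T2 *m Y *m (M *m Y *m S2).
  by rewrite hX /M !mulmxA.
have a : A *m X *m A = A <-> qrank M = nu.
  rewrite -hA; split=> [AXA | eqr].
    apply/eqP; rewrite eqn_leq leMA /=.
    (* Expanding [A = A X A X A] puts [M] in the middle of a product equal to [A]. *)
    have -> : A = A *m T2 *m Y *m M *m (Y *m S2 *m A).
      have AXAXA : A *m X *m A *m X *m A = A by rewrite !AXA.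
      by rewrite -[LHS]AXAXA hX /M !mulmxA.
    exact: qrank_mulmx_mid.
  (* The ranks of [A T2] and [S2 A] lie between those of [M] and [A], so all of them coincide. *)
  have [U AU] : exists U, A = A *m T2 *m U.
    apply: qrank_eq_mulmxl; apply/eqP; rewrite eqn_leq qrank_mulmxl /= -eqr.
    by rewrite /M -mulmxA qrank_mulmxr.
  have [V AV] : exists V, A = V *m (S2 *m A).
    apply: qrank_eq_mulmxr; apply/eqP; rewrite eqn_leq qrank_mulmxr /= -eqr.
    exact: qrank_mulmxl.
  transitivity (V *m (M *m Y *m M) *m U).
    by rewrite {1}AV {2}AU hX /M !mulmxA.
  by rewrite hY /M -!mulmxA (mulmxA A) -AU -AV.
have b : (X *m A *m X = X /\ lrange X = lrange S2) <-> qrank M = qrank S2.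
  split=> [[XAX rX] | eqr].
    apply/eqP; rewrite eqn_leq leMS /=.
    have [|Z ->] := (lrangeP S2 X).1; first by rewrite rX.
    (* Here [S2 = Z X], and [X = X A X] contains the factor [M]. *)
    have -> : Z *m X = Z *m T2 *m Y *m M *m (Y *m S2).
      by rewrite -[in LHS]XAX XAX_def !mulmxA.
    exact: qrank_mulmx_mid.
  have [U SU] : exists U, S2 = M *m U.
    have := @qrank_eq_mulmxl _ _ _ _ S2 (A *m T2).
    by rewrite mulmxA => /(_ eqr).
  (* Writing [S2 = M U] lets [M Y M = M] cancel [Y]. *)
  have MYS : M *m Y *m S2 = S2 by rewrite {1}SU mulmxA hY -SU.
  split; first by rewrite XAX_def MYS -hX.
  apply/seteqP; split; apply/lrangeP; first by exists (T2 *m Y).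
  by exists (S2 *m A); rewrite -{1}MYS hX /M !mulmxA.
have c : (X *m A *m X = X /\ lnull X = lnull T2) <-> qrank M = qrank T2.
  split=> [[XAX nX] | eqr].
    apply/eqP; rewrite eqn_leq leMT /=.
    (* [1 - X A] kills [X], hence also [T2], so that [T2 = X A T2 = T2 Y M]. *)
    have /eqP : (1%:M - X *m A) *m T2 = 0.
      apply: (@lnull_mulmx _ _ _ _ _ X); first by rewrite nX.
      by rewrite mulmxBl mul1mx XAX subrr.
    rewrite mulmxBl mul1mx subr_eq0 => /eqP ->.
    have -> : X *m A *m T2 = T2 *m Y *m M by rewrite hX /M !mulmxA.
    exact: qrank_mulmxr.
  have [V TV] := qrank_eq_mulmxr eqr.
  have TYM : T2 *m Y *m M = T2 by rewrite {1}TV -(mulmxA V M Y) -(mulmxA V _ M) hY -TV.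
  split; first by rewrite XAX_def (mulmxA _ (M *m Y)) (mulmxA _ M) TYM -hX.
  apply/seteqP; split=> x; rewrite /lnull /= => x0.
    have -> : x *m T2 = x *m X *m A *m T2 by rewrite -[in LHS]TYM hX /M !mulmxA.
    by rewrite x0 !mul0mx.
  by rewrite hX !mulmxA x0 !mul0mx.
(* Parts (d) and (e) assemble (a), (b) and (c); uniqueness in both comes from [is_inv2_inj]. *)
do 3!split=> //; split.
- split=> [[[XAX rX nX] _] | [rS rT]].
    by have rS := b.1 (conj XAX rX); split=> //; rewrite -rS; apply/c.
  have [XAX rX] := b.2 rS; have [_ nX] := c.2 (etrans rS rT).
  by have iX : is_inv2 A S2 T2 X by []; split=> // X' /(is_inv2_inj iX).
split=> [[[AXA XAX rX nX] _] | [rS rT rA]].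
  have rS := b.1 (conj XAX rX); have rT := c.1 (conj XAX nX).
  by split=> //; rewrite -?rS -?rT //; apply/a.
have [XAX rX] := b.2 rS; have [_ nX] := c.2 (etrans rS rT).
have AXA := a.2 (etrans rS (etrans rT rA)).
split=> // X' [_ XAX' rX' nX'].
exact: (@is_inv2_inj _ _ _ _ _ A S2 T2).
Qed.
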